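(* In the case of dependent labels and when $J=2$, there exists a nonempty subset $\tilde\Theta\subset\Theta^{\mathrm{dep}}$ such that for all $\theta\in\tilde\Theta$ and all $n\ge2$, $$\mathbb{P}_\theta\left(g^\star_\theta(Y_{1:n})\ne\pi_n\circ h^\star_\theta(Y_{1:n})\right)>0.$$
   Context: Model. $J\ge2$ is an integer, $\mathbb{X}=\{1,\dots,J\}$, $(\mathbb{Y},\mathcal{Y})$ is a Polish space with its Borel $\sigma$-field and $\mathcal{L}$ is a dominating measure on it. A parameter is $\theta=(\nu,Q,(f_x)_{x\in\mathbb{X}})$ with $\nu$ a probability vector on $\mathbb{X}$, $Q$ a $J\times J$ transition matrix and $f_x$ probability densities with respect to $\mathcal{L}$. Under $\mathbb{P}_\theta$ (expectation $\mathbb{E}_\theta$), $(X_i)_{i\ge1}$ is a Markov chain on $\mathbb{X}$ with initial law $\nu$ and transition matrix $Q$ and, conditionally on $(X_i)_{i\ge 1}$, the $Y_i$ are independent, $Y_i$ having density $f_{X_i}$. $Y_{1:n}=(Y_1,\dots,Y_n)$. $\Theta^{\mathrm{dep}}$ is the set of parameters for which the rows of $Q$ are not all equal. Clusterers and classifiers. $\mathcal{P}[n]$ is the set of partitions of $[n]=\{1,\dots,n\}$. An $n$-clusterer is a measurable map $g:\mathbb{Y}^n\to\mathcal{P}[n]$; an $n$-classifier is a measurable map $h=(h_1,\dots,h_n):\mathbb{Y}^n\to\mathbb{X}^n$. $\pi_n:\mathbb{X}^n\to\mathcal{P}[n]$ is $\pi_n(x_{1:n})=\{\{i:x_i=x\}:x\in\mathbb{X}\}\setminus\{\varnothing\}$,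 and $\Pi_n=\pi_n(X_{1:n})$. For partitions $A,B$ of $[n]$, $\ell(A,B)=1-\frac1n\sup_M\sum_{\{C,C'\}\in M}\mathrm{Card}(C\cap C')$, the supremum being over matchings $M$ between the blocks of $A$ and the blocks of $B$ in the complete bipartite graph (each block is in at most one edge). The Bayes clusterer $g^\star_\theta$ is the clusterer such that $g^\star_\theta(Y_{1:n})$ is the partition minimizing $g\mapsto\mathbb{E}_\theta[\ell(g(Y_{1:n}),\Pi_n)\mid Y_{1:n}]$. The (not necessarily unique) Bayes classifier $h^\star_\theta=(h^\star_{\theta,1},\dots,h^\star_{\theta,n})$ satisfies $\mathbb{P}_\theta(X_i=h^\star_{\theta,i}(Y_{1:n})\mid Y_{1:n})=\max_{x\in\mathbb{X}}\mathbb{P}_\theta(X_i=x\mid Y_{1:n})$ for $i=1,\dots,n$.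
   Formalization: It is assumed in addition that there are two probability densities with respect to the dominating measure that are not almost everywhere equal; without this (e.g. zero measure, or a one-point observation space) the claim fails. *)

(* Defs.v *)
From HB Require Import structures.
From mathcomp Require Import all_boot all_order all_algebra.
From mathcomp Require Import all_classical all_reals all_analysis.

Set Implicit Arguments.
Unset Strict Implicit.
Unset Printing Implicit Defensive.

Import Order.TTheory GRing.Theory Num.Theory.
Import numFieldNormedType.Exports.

Local Open Scope classical_set_scope.
Local Open Scope ring_scope.

(* Labels {1, ..., J} are encoded as 'I_J, and
   the time indices 1, 2, ... are shifted to 0, 1, .... *)

(* Separable and metrizable by a complete metric; the metric is not part of
   the data. *)
Definition polish (R : realType) (T : topologicalType) : Prop :=
  exists dist : T -> T -> R,
    [/\ (forall x y, dist x y = 0 <-> x = y),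
        (forall x y, dist x y = dist y x)
      & (forall x y z, dist x z <= dist x y + dist y z)] /\
    [/\ (forall (x : T) (A : set T), nbhs x A <->
           exists2 e : R, 0 < e & [set y | dist x y < e] `<=` A),
        (forall u : nat -> T,
           (forall e : R, 0 < e -> exists N, forall m k,
              (N <= m)%N -> (N <= k)%N -> dist (u m) (u k) < e) ->
           exists l : T, u n @[n --> \oo] --> l)
      & exists2 D : set T, countable D & dense D].

Notation borel T := (g_sigma_algebraType (@open T)).

Definition is_density (R : realType) (d : measure_display)
    (T : measurableType d) (L : {measure set T -> \bar R}) (f : T -> R)
    : Prop :=
  [/\ measurable_fun [set: T] f, (forall y, 0 <= f y)
    & (\int[L]_y (f y)%:E = 1)%E].

(* At least two different laws are absolutely continuous with respect to L. *)
Definition two_densities (R : realType) (d : measure_display)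
    (T : measurableType d) (L : {measure set T -> \bar R}) : Prop :=
  exists f1 f2 : T -> R,
    [/\ is_density L f1, is_density L f2
      & ~ {ae L, forall y, f1 y = f2 y}].

Record param (R : realType) (J : nat) (T : Type) := Param {
  init : 'I_J -> R ;
  trans : 'M[R]_J ;
  emis : 'I_J -> T -> R }.

Definition Theta (R : realType) (J : nat) (d : measure_display)
    (T : measurableType d) (L : {measure set T -> \bar R})
    : set (param R J T) :=
  [set th |
    [/\ (forall x, 0 <= init th x) /\ \sum_x init th x = 1,
        (forall x x', 0 <= trans th x x') /\
          (forall x, \sum_x' trans th x x' = 1)
      & (forall x, is_density L (emis th x))]].

Definition Theta_dep (R : realType) (J : nat) (d : measure_display)
    (T : measurableType d) (L : {measure set T -> \bar R})
    : set (param R J T) :=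
  [set th | Theta L th /\
            exists x x' : 'I_J, row x (trans th) <> row x' (trans th)].

(* (X, Y) is a hidden Markov model with parameter th under P, through its
   finite-dimensional laws. *)
Record is_hmm (R : realType) (J : nat) (d : measure_display)
    (T : measurableType d) (L : {measure set T -> \bar R}) (th : param R J T)
    (dO : measure_display) (Om : measurableType dO) (P : probability Om R)
    (X : nat -> Om -> 'I_J) (Y : nat -> Om -> T) : Prop := IsHmm {
  hmm_measX : forall i x, measurable (X i @^-1` [set x]) ;
  hmm_measY : forall i, measurable_fun [set: Om] (Y i) ;
  hmm_chain : forall (n : nat) (x : nat -> 'I_J),
    (P [set w | forall i, (i <= n)%N -> X i w = x i] =
     (init th (x 0%N) * \prod_(i < n) trans th (x i) (x i.+1))%:E)%E ;
  hmm_obs : forall (n : nat) (x : nat -> 'I_J) (A : nat -> set T),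
    (forall i, measurable (A i)) ->
    (P [set w | forall i, (i <= n)%N -> X i w = x i /\ A i (Y i w)] =
     P [set w | forall i, (i <= n)%N -> X i w = x i] *
     \prod_(i < n.+1) \int[L]_(y in A i) (emis th (x i) y)%:E)%E }.

Definition labels (J : nat) (Om : Type) (X : nat -> Om -> 'I_J) (n : nat)
    (w : Om) : {ffun 'I_n -> 'I_J} := [ffun i : 'I_n => X i w].

Definition observations (T Om : Type) (Y : nat -> Om -> T) (n : nat)
    (w : Om) : n.-tuple T := [tuple Y i w | i < n].

Definition label_partition (J n : nat) (x : {ffun 'I_n -> 'I_J})
    : {set {set 'I_n}} :=
  ([set [set i | x i == a] | a : 'I_J] :\ finset.set0)%SET.

(* An edge {C, C'} of the complete bipartite graph is the pair (C, C') with
   C in A and C' in B: a block common to A and B gives two vertices. *)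
Definition is_matching (n : nat) (A B : {set {set 'I_n}})
    (M : {set {set 'I_n} * {set 'I_n}}) : bool :=
  (M \subset finset.setX A B) &&
  [forall e in M, forall e' in M,
     ((e.1 == e'.1) || (e.2 == e'.2)) ==> (e == e')].

Definition loss (R : realType) (n : nat) (A B : {set {set 'I_n}}) : R :=
  1 - n%:R^-1 *
    (\max_(M | is_matching A B M) \sum_(e in M) #|e.1 :&: e.2|%SET)%N%:R.

Definition is_clusterer (d : measure_display) (T : measurableType d) (n : nat)
    (g : n.-tuple T -> {set {set 'I_n}}) : Prop :=
  (forall y, finset.partition (g y) [set: 'I_n]%SET) /\
  (forall C, measurable (g @^-1` [set C])).

Definition is_classifier (J : nat) (d : measure_display)
    (T : measurableType d) (n : nat)
    (h : n.-tuple T -> {ffun 'I_n -> 'I_J}) : Prop :=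
  forall x, measurable (h @^-1` [set x]).

(* phi(W) is a version of the conditional expectation of Z given W. *)
Definition is_cond_exp (R : realType) (dO : measure_display)
    (Om : measurableType dO) (P : probability Om R) (d : measure_display)
    (S : measurableType d) (W : Om -> S) (Z : Om -> R) (phi : S -> R)
    : Prop :=
  [/\ measurable_fun [set: S] phi,
      P.-integrable [set: Om] (fun w => (phi (W w))%:E)
    & forall B : set S, measurable B ->
        (\int[P]_(w in W @^-1` B) (phi (W w))%:E =
         \int[P]_(w in W @^-1` B) (Z w)%:E)%E].

Definition is_cond_prob (R : realType) (dO : measure_display)
    (Om : measurableType dO) (P : probability Om R) (d : measure_display)
    (S : measurableType d) (W : Om -> S) (E : set Om) (phi : S -> R) : Prop :=
  is_cond_exp P W (\1_E : Om -> R) phi.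

Definition is_bayes_clusterer (R : realType) (J : nat) (d : measure_display)
    (T : measurableType d) (dO : measure_display) (Om : measurableType dO)
    (P : probability Om R) (X : nat -> Om -> 'I_J) (Y : nat -> Om -> T)
    (n : nat) (g : n.-tuple T -> {set {set 'I_n}}) : Prop :=
  let Yn := observations Y n in
  let risk (g' : n.-tuple T -> {set {set 'I_n}}) :=
    is_cond_exp P Yn
      (fun w => loss R (g' (Yn w)) (label_partition (labels X n w))) in
  is_clusterer g /\
  forall g', is_clusterer g' -> forall phi phi' : n.-tuple T -> R,
    risk g phi -> risk g' phi' ->
    {ae P, forall w, phi (Yn w) <= phi' (Yn w)}.

(* The neutral element 0 of the iterated maximum is harmless since conditional
   probabilities are nonnegative almost surely. *)
Definition is_bayes_classifier (R : realType) (J : nat) (d : measure_display)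
    (T : measurableType d) (dO : measure_display) (Om : measurableType dO)
    (P : probability Om R) (X : nat -> Om -> 'I_J) (Y : nat -> Om -> T)
    (n : nat) (h : n.-tuple T -> {ffun 'I_n -> 'I_J}) : Prop :=
  let Yn := observations Y n in
  is_classifier h /\
  forall (i : 'I_n) (q : n.-tuple T -> R) (p : 'I_J -> n.-tuple T -> R),
    is_cond_prob P Yn [set w | X i w = h (Yn w) i] q ->
    (forall x, is_cond_prob P Yn [set w | X i w = x] (p x)) ->
    {ae P, forall w, q (Yn w) = \big[Order.max/0]_(x < J) p x (Yn w)}.

(* Main.v *)
Require Import Defs.
From HB Require Import structures.
From mathcomp Require Import all_boot all_order all_algebra.
From mathcomp Require Import all_classical all_reals all_analysis.
From mathcomp Require Import measurable_realfun.
From mathcomp Require Import zify ring lra.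

Set Implicit Arguments.
Unset Strict Implicit.
Unset Printing Implicit Defensive.
Import Order.TTheory GRing.Theory Num.Theory.
Import numFieldNormedType.Exports.

Local Open Scope classical_set_scope.
Local Open Scope ring_scope.

(** Let u and v be densities with disjoint supports, and consider the chain
    started from (2/3, 1/3) whose first state is absorbing and whose second
    state is left with probability 1/2, with emission densities (u + v) / 2 and
    v. When all the observations fall where u vanishes, the posterior law does
    not depend on them: it charges only the label sequences 2^k 1^(n-k),
    0 <= k <= n, with weights proportional to 2, 1, ..., 1, 2. The Bayes
    classifier then outputs 2^j 1^(n-j) for some 0 < j < n. For two labels, the
    loss between the partitions of 2^j 1^(n-j) and 2^k 1^(n-k) is 1/n times
    the distance of j and k on the cycle Z/n. On this cycle k = 0 and k = n are
    the same point and carry weight 4, against 1 for the other points; as the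
    sum of the distances to a point does not depend on the point, the
    one-block partition, which corresponds to the point 0, has strictly smaller
    risk than any point j <> 0. *)

(** * Combinatorics of the loss *)

Definition overlap n (A B : {set {set 'I_n}}) : nat :=
  (\max_(M | is_matching A B M) \sum_(e in M) #|e.1 :&: e.2|%SET)%N.

Definition cell J n (x : {ffun 'I_n -> 'I_J}) (a : 'I_J) : {set 'I_n} :=
  [set i | x i == a]%SET.

Lemma label_partitionP J n (x : {ffun 'I_n -> 'I_J}) (C : {set 'I_n}) :
  C \in label_partition x -> exists a, C = cell x a.
Proof. by rewrite !inE => /andP[_ /imsetP[a _ ->]]; exists a. Qed.

(** The index 0 lies in exactly one of the two cells. With more labels, two cells could both be
    empty. *)
Lemma cell_inj n (x : {ffun 'I_n -> 'I_2}) : (0 < n)%N -> injective (cell x).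
Proof.
move=> n0 a b /setP/(_ (Ordinal n0)); rewrite !inE => xab.
by apply/val_inj; move: xab; rewrite -!val_eqE /=;
  case: (x _) a b => [[|[|]]//= ?] [[|[|]]//= ?] [[|[|]]//= ?].
Qed.

(* A matching between the two blocks of x and the two blocks of y is part of
   one of the two perfect matchings of these blocks. *)
Lemma overlap_labels_le n (x y : {ffun 'I_n -> 'I_2}) : (0 < n)%N ->
  (overlap (label_partition x) (label_partition y) <=
   maxn (\sum_c #|cell x c :&: cell y c|%SET)
        (\sum_c #|cell x c :&: cell y (rev_ord c)|%SET))%N.
Proof.
move=> n0; apply/bigmax_leqP => M /andP[/fintype.subsetP MAB /forall_inP matchM].
have edge e : e \in M -> exists s t, e = (cell x s, cell y t).
  move=> /MAB; case: e => C D; rewrite inE /= => /andP[].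
  by move=> /label_partitionP[s ->] /label_partitionP[t ->]; exists s, t.
have bound (sg : 'I_2 -> 'I_2) :
    (forall s t, (cell x s, cell y t) \in M -> t = sg s) ->
    (\sum_(e in M) #|e.1 :&: e.2|%SET <=
     \sum_c #|cell x c :&: cell y (sg c)|%SET)%N.
  move=> Msg; pose F c := (cell x c, cell y (sg c)).
  have Finj : {in predT &, injective F}.
    by move=> a b _ _ [/(cell_inj n0)].
  rewrite -(big_imset (fun e => #|e.1 :&: e.2|%SET) Finj)/=.
  apply: (sub_le_big (le := leq)) => //; first by move=> ? ?; exact: leq_addr.
  move=> e eM; have [s [t est]] := edge _ eM.
  by apply/imsetP; exists s => //; rewrite est /F (Msg s t) -?est.
have [/existsP[c cM]|/existsPn noM] :=
    boolP [exists c, (cell x c, cell y c) \in M].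
  apply: leq_trans (leq_maxl _ _); apply: (bound id) => s t stM.
  have /forall_inP/(_ _ cM) := matchM _ stM.
  have [->|sc] := eqVneq s c.
    by rewrite /= eqxx /= => /eqP[/(cell_inj n0)].
  have [->|tc] := eqVneq t c.
    by rewrite /= eqxx orbT /= => /eqP[/(cell_inj n0)].
  by move=> _; apply/val_inj; move: sc tc; rewrite -!val_eqE /=;
    case: c s t {cM stM} => [[|[|]]//= ?] [[|[|]]//= ?] [[|[|]]//= ?].
apply: leq_trans (leq_maxr _ _); apply: (bound (@rev_ord 2)) => s t stM.
have : s != t by apply: contraL stM => /eqP ->; exact: noM.
move=> st; apply/val_inj; move: st; rewrite -!val_eqE /=.
by case: s t {stM} => [[|[|]]//= ?] [[|[|]]//= ?].
Qed.

(** A single edge, from the only block to the cell, is a matching. An empty cell is not a block and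
    is treated apart. *)
Lemma overlap_trivial_ge J n (y : {ffun 'I_n -> 'I_J}) c :
  (#|cell y c| <= overlap [set [set: 'I_n]] (label_partition y))%SET%N.
Proof.
have [->|y0] := eqVneq (cell y c) finset.set0; first by rewrite cards0.
pose M := [set ([set: 'I_n], cell y c)]%SET.
have mM : is_matching [set [set: 'I_n]]%SET (label_partition y) M.
  apply/andP; split.
    apply/fintype.subsetP => e; rewrite inE => /eqP ->.
    by rewrite !inE eqxx y0 /=; apply/imsetP; exists c.
  apply/forall_inP => e; rewrite inE => /eqP ->.
  by apply/forall_inP => e'; rewrite inE => /eqP ->; rewrite !eqxx.
apply: leq_trans (leq_bigmax_cond _ mM).
by rewrite big_set1 /= finset.setTI.
Qed.

(* Distance between two points of Z/n that differ by d <= n. *)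
Definition cyc n d := minn d (n - d).

(** Invariance under rotation of the cycle: the terms with [k >= j] are shifted down by [j] and
    those with [k < j] are shifted up by [n - j], as [cyc n d = cyc n (n - d)] for [d <= n]. *)
Lemma sum_cyc_shift n j : (j <= n)%N ->
  (\sum_(0 <= k < n) cyc n ((j - k) + (k - j)) = \sum_(0 <= k < n) cyc n k)%N.
Proof.
move=> jn; rewrite (big_cat_nat (n := j))//= [RHS](big_cat_nat (n := n - j))//=;
  last exact: leq_subr.
rewrite addnC; congr (_ + _)%N.
  rewrite -{1}[j]add0n big_addn; apply: eq_big_nat => i _.
  by rewrite addnK (_ : j - (i + j) = 0)%N//; lia.
rewrite -[(n - j)%N]add0n big_addn subKn//; apply: eq_big_nat => i /andP[_ ij].
by rewrite /cyc; lia.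
Qed.

(* The label sequence 2^k 1^(n-k): the labels 1 and 2 are ord0 and ord_max. *)
Definition stair n k : {ffun 'I_n -> 'I_2} :=
  [ffun i : 'I_n => if (i < k)%N then ord_max else ord0].

Lemma card_ord_itv n a b : (b <= n)%N ->
  #|[set i : 'I_n | (a <= i < b)%N]|%SET = (b - a)%N.
Proof.
move=> bn; rewrite -sum1_card -[(b - a)%N]muln1 -sum_nat_const_nat.
rewrite (eq_bigl (fun i : 'I_n => (a <= i < b)%N)); last by move=> i; rewrite inE.
rewrite -(big_mkord (fun i => (a <= i < b)%N) (fun _ => 1%N)).
rewrite [LHS](big_cat_nat (n := b))//= [X in (_ + X)%N]big_nat_cond.
rewrite [X in (_ + X)%N]big_pred0 => [|i]; last lia.
rewrite addn0; have [ab|ba] := leqP a b.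
  rewrite (big_cat_nat (n := a))//= big_nat_cond big_pred0 => [|i]; last lia.
  rewrite add0n big_nat_cond [RHS]big_nat_cond; apply: eq_bigl => i; lia.
by rewrite big_nat_cond big_pred0 => [|i]; [rewrite big_geq//; exact: ltnW|lia].
Qed.

(** With d = |j - k|, the two perfect matchings of the cells cover n - d and d indices, and the
    larger of these numbers is [n - cyc n d]. *)
Lemma overlap_stair_le n j k : (0 < n)%N -> (j <= n)%N -> (k <= n)%N ->
  (overlap (label_partition (stair n j)) (label_partition (stair n k)) <=
   n - cyc n ((j - k) + (k - j)))%N.
Proof.
move=> n0 jn kn; apply: leq_trans (overlap_labels_le _ _ n0) _.
(* Cells of two stairs meet along an interval, so that the four cardinals reduce to arithmetic. Of
   the mixed intersections [j, k) and [k, j), at least one is empty. *)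
have cap (c d : 'I_2) a b : (b <= n)%N ->
    (forall i, (i < n)%N -> ((i < j) == (c == 1 :> nat)) &&
      ((i < k) == (d == 1 :> nat)) = (a <= i < b))%N ->
    #|cell (stair n j) c :&: cell (stair n k) d|%SET = (b - a)%N.
  move=> bn E; rewrite -(card_ord_itv a bn).
  apply: eq_card => i; rewrite !inE !ffunE -E//.
  by case: c d {E} => [[|[|]]//= ?] [[|[|]]//= ?]; do 2!case: ifP.
rewrite !big_ord_recl !big_ord0 /= !addn0.
rewrite (cap _ _ (maxn j k) n)// => [|i ?]; last by rewrite /= /bump /=; lia.
rewrite (cap _ _ 0 (minn j k))%N// => [||i ?]; last by rewrite /= /bump /=; lia.
  rewrite (cap _ _ j k)%N// => [|i ?]; last by rewrite /= /bump /=; lia.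
  rewrite (cap _ _ k j)%N// => [|i ?]; last by rewrite /= /bump /=; lia.
  by rewrite /cyc; lia.
lia.
Qed.

(** The single block can be matched with either cell, of size [k] or [n - k]; the larger size is
    [n - cyc n k]. *)
Lemma overlap_trivial_stair n k : (k <= n)%N ->
  (n - cyc n k <=
   overlap [set [set: 'I_n]]%SET (label_partition (stair n k)))%N.
Proof.
move=> kn.
have := overlap_trivial_ge (stair n k) ord_max.
have -> : #|cell (stair n k) ord_max| = k.
  rewrite -[RHS]subn0 -(card_ord_itv 0 kn); apply: eq_card => i.
  by rewrite !inE ffunE; case: ifP.
have := overlap_trivial_ge (stair n k) ord0.
have -> : #|cell (stair n k) ord0| = (n - k)%N.
  rewrite -(card_ord_itv k (leqnn n)); apply: eq_card => i.
  by rewrite !inE ffunE ltn_ord andbT; case: ltnP.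
by rewrite /cyc; lia.
Qed.

Definition stair_weight n k : nat := if (0 < k < n)%N then 1 else 2.

(** The form isolates the sum over the cycle. When [F] is a function on Z/n, the points 0 and n are
    identified and the excess weight is [3 * F 0]. *)
Lemma sum_stair_weight n (F : nat -> nat) : (0 < n)%N ->
  (\sum_(k < n.+1) stair_weight n k * F k =
   \sum_(0 <= k < n) F k + F 0 + 2 * F n)%N.
Proof.
move=> n0; rewrite big_ord_recr /= {2}/stair_weight ltnn andbF.
case: n n0 => // n _; rewrite big_ord_recl big_nat_recl// big_mkord.
under eq_bigr => i _ do
  rewrite /stair_weight /= /bump /= add1n ltnS ltn_ord mul1n.
by rewrite /stair_weight /=; lia.
Qed.

Lemma trivial_beats_stair n j : (0 < j < n)%N ->
  (\sum_(k < n.+1) stair_weight n k *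
     overlap (label_partition (stair n j)) (label_partition (stair n k)) <
   \sum_(k < n.+1) stair_weight n k *
     overlap [set [set: 'I_n]]%SET (label_partition (stair n k)))%N.
Proof.
move=> /andP[j0 jn]; have n0 : (0 < n)%N by lia.
(* [s] is the total distance to any given point of the cycle, and [tot] would be the weighted
   overlap if all distances were 0. The deficit from [tot] is at least [s + 3 * cyc n j] for the
   stair and at most [s] for the single block. *)
pose s := (\sum_(0 <= k < n) cyc n k)%N.
pose tot := (\sum_(k < n.+1) stair_weight n k * n)%N.
have lhs : (\sum_(k < n.+1) stair_weight n k *
     overlap (label_partition (stair n j)) (label_partition (stair n k)) +
     (s + 3 * cyc n j) <= tot)%N.
  apply: (@leq_trans (\sum_(k < n.+1) stair_weight n k *
      (n - cyc n ((j - k) + (k - j))) +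
      \sum_(k < n.+1) stair_weight n k * cyc n ((j - k) + (k - j)))%N).
    rewrite leq_add//.
      apply: leq_sum => k _; rewrite leq_mul2l; apply/orP; right.
      by apply: overlap_stair_le => //; [lia|exact: (ltn_ord k)].
    rewrite (sum_stair_weight (fun k => cyc n ((j - k) + (k - j))))//.
    rewrite sum_cyc_shift; last lia.
    by rewrite /s /cyc; lia.
  rewrite -big_split /=; apply: leq_sum => k _.
  by rewrite -mulnDr leq_mul2l /cyc; apply/orP; right; have := ltn_ord k; lia.
have rhs : (tot <= \sum_(k < n.+1) stair_weight n k *
     overlap [set [set: 'I_n]]%SET (label_partition (stair n k)) + s)%N.
  have -> : s = (\sum_(k < n.+1) stair_weight n k * cyc n k)%N.
    by rewrite (sum_stair_weight (cyc n))// /s {3 4}/cyc; lia.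
  rewrite -big_split /=; apply: leq_sum => k _.
  rewrite -mulnDr leq_mul2l; apply/orP; right.
  have := overlap_trivial_stair (ltn_ord k : (k <= n)%N); lia.
have : (0 < cyc n j)%N by rewrite /cyc; lia.
lia.
Qed.

Lemma stair_inj n : {in [pred k | (k <= n)%N] &, injective (stair n)}.
Proof.
have lt k l : (k < l <= n)%N -> stair n k <> stair n l.
  move=> /andP[kl ln] /ffunP/(_ (Ordinal (leq_trans kl ln))).
  by rewrite !ffunE /= ltnn kl.
move=> k l; rewrite !inE => kn ln kl.
have [klt|lkt|//] := ltngtP k l.
  by case: (lt k l) => //; rewrite klt.
by case: (lt l k) => //; rewrite lkt.
Qed.

(** Posterior mass, up to normalisation, of the label 2 at index [i]; the next lemma gives that of
    the label 1. *)
Lemma sum_stair_weight_gt n i : (i < n)%N ->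
  (\sum_(k < n.+1) stair_weight n k * (i < k) = n.+1 - i)%N.
Proof.
move=> lin; have n0 : (0 < n)%N by lia.
rewrite (sum_stair_weight (fun k => (i < k) : nat))// ltn0 lin.
rewrite (big_cat_nat (n := i.+1))//= big_nat big1 => [|k]; last by lia.
rewrite (eq_big_nat _ _ (F2 := fun=> 1%N)) => [|k]; last by lia.
by rewrite sum_nat_const_nat; lia.
Qed.

Lemma sum_stair_weight_le n i : (i < n)%N ->
  (\sum_(k < n.+1) stair_weight n k * (k <= i) = i.+2)%N.
Proof.
move=> lin; have n0 : (0 < n)%N by lia.
rewrite (sum_stair_weight (fun k => (k <= i) : nat))// leq0n (leqNgt n) lin.
have -> : (\sum_(0 <= k < n) (k <= i) = i.+1)%N.
  rewrite (big_cat_nat (n := i.+1))//= [X in (_ + X)%N]big_nat.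
  rewrite [X in (_ + X)%N]big1 => [|k]; last by lia.
  rewrite (eq_big_nat _ _ (F2 := fun=> 1%N)) => [|k]; last by lia.
  by rewrite sum_nat_const_nat; lia.
by lia.
Qed.

(** The hypotheses say that each label has maximal posterior mass, [n + 1 - i] being compared with
    [i + 2]. They fix every label except at the middle index of an odd [n], where the two masses
    tie. *)
Lemma majority_stair n (x : {ffun 'I_n -> 'I_2}) : (1 < n)%N ->
  (forall i, x i = ord_max -> (i.*2 < n)%N) ->
  (forall i, x i = ord0 -> (n <= i.*2.+1)%N) ->
  exists2 j, (0 < j < n)%N & x = stair n j.
Proof.
move=> n1 x1 x0.
(* [b] records how the tie at the middle index is broken, which moves the threshold by one. *)
pose b := [exists i : 'I_n, (i.*2.+1 == n) && (x i == ord_max)].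
have binary (i : 'I_n) : x i = ord0 \/ x i = ord_max.
  case E: (x i) => [[|[|k]] lk] //; [left|right]; exact/val_inj.
have bE (i : 'I_n) : (i.*2.+1 == n) -> b = (x i == ord_max).
  move=> iE; apply/existsP/idP => [[k /andP[kE]]|xi]; last by exists i; rewrite iE.
  by have -> : k = i by apply/val_inj => /=; lia.
exists (n./2 + b)%N.
  case: (boolP b) => [/existsP[i /andP[iE _]]|_]; lia.
have bodd : b -> odd n.
  by move=> /existsP[k /andP[/eqP kn _]]; lia.
apply/ffunP => i; rewrite ffunE; have [xi|xi] := binary i; rewrite xi.
  case: ltnP => // ib; exfalso; have := x0 i xi.
  have : b -> i.*2.+1 != n by move=> bt; apply/negP => /bE; rewrite xi bt.
  by case: b ib bodd {bE} => /= ib; [move=> /(_ isT) ? /(_ isT)|move=> _ _]; lia.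
case: ltnP => // ib; exfalso; have := x1 i xi.
have : ~~ b -> i.*2.+1 != n.
  by move=> bf; apply/negP => /bE bt; rewrite bt xi eqxx in bf.
by case: b ib bodd {bE} => /= ib; [move=> /(_ isT) ? _|move=> _ /(_ isT)]; lia.
Qed.

Lemma sum_loss (R : realType) n (A : {set {set 'I_n}})
    (B : 'I_n.+1 -> {set {set 'I_n}}) (w : 'I_n.+1 -> nat) :
  \sum_k (w k)%:R * loss R A (B k) =
  (\sum_k w k)%:R - n%:R^-1 * (\sum_k w k * overlap A (B k))%N%:R.
Proof.
rewrite !natr_sum mulr_sumr -sumrB; apply: eq_bigr => k _.
by rewrite natrM /loss -/(overlap _ _) mulrBr mulr1 mulrCA.
Qed.

(** The first components of the edges of a matching are distinct blocks of [A], and all the blocks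
    of [A] together have [n] elements. *)
Lemma overlap_le_card n (A B : {set {set 'I_n}}) :
  finset.partition A [set: 'I_n]%SET ->
  (overlap A B <= n)%N.
Proof.
move=> /card_partition; rewrite cardsT card_ord => nE.
apply/bigmax_leqP => M /andP[/fintype.subsetP MAB /forall_inP matchM].
have inj1 : {in M &, injective (@fst {set 'I_n} {set 'I_n})}.
  move=> e e' eM e'M ee'; apply/eqP.
  by have /forall_inP/(_ _ e'M) := matchM _ eM; rewrite ee' eqxx.
apply: leq_trans (_ : \sum_(e in M) #|e.1| <= _)%N.
  by apply: leq_sum => e _; exact: subset_leq_card (finset.subsetIl _ _).
rewrite -(big_imset (fun C : {set 'I_n} => #|C|) inj1) [leqRHS]nE.
apply: (sub_le_big (le := leq)) => //; first by move=> ? ?; exact: leq_addr.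
by move=> _ /imsetP[e /MAB eAB ->]; move: eAB; case: e => ? ? /setXP[].
Qed.

Lemma loss_ge0 (R : realType) n (A B : {set {set 'I_n}}) :
  finset.partition A [set: 'I_n]%SET -> 0 <= loss R A B.
Proof.
move=> /overlap_le_card-/(_ B); rewrite /loss -/(overlap A B).
case: n A B => [|n] A B le.
  by rewrite invr0 mul0r subr0.
by rewrite subr_ge0 ler_pdivrMl ?ltr0n// mulr1 ler_nat.
Qed.

Lemma loss_le1 (R : realType) n (A B : {set {set 'I_n}}) : loss R A B <= 1.
Proof. by rewrite /loss gerBl mulr_ge0// invr_ge0. Qed.

(** * Conditional expectations and the Bayes rules *)

Section finitely_valued.
Context (R : realType) (d : measure_display) (T : measurableType d).
Context (I : finType) (a : T -> I).
Hypothesis ma : forall i, measurable (a @^-1` [set i]).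

Lemma measurable_finite_preimage (Q : set I) : measurable (a @^-1` Q).
Proof.
have -> : a @^-1` Q = \bigcup_(i in Q) a @^-1` [set i].
  by apply/seteqP; split=> [w Qw|w [i Qi /= wi]]; [exists (a w)|rewrite wi].
by apply: fin_bigcup_measurable => // i _; exact: ma.
Qed.

Lemma measurable_finitely_valued (F : I -> R) :
  measurable_fun [set: T] (F \o a).
Proof.
by move=> _ B _; rewrite setTI; exact: (measurable_finite_preimage (F @^-1` B)).
Qed.

Lemma integral_finitely_valued (P : {measure set T -> \bar R}) (F : I -> R)
    (D : set T) : (forall i, 0 <= F i) -> measurable D ->
  (\int[P]_(w in D) (F (a w))%:E =
   \sum_i (F i)%:E * P (D `&` a @^-1` [set i]))%E.
Proof.
move=> F0 mD.
have FE w : (F (a w))%:E = (\sum_i (F i)%:E * (\1_(a @^-1` [set i]) w)%:E)%E.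
  rewrite (bigD1 (a w))//= indicE mem_set// mule1 big1 ?adde0// => i iaw.
  by rewrite indicE memNset ?mule0//= => /esym/eqP; apply/negP.
under eq_integral do rewrite FE.
have mI i : measurable_fun D (EFin \o \1_(a @^-1` [set i]) : T -> \bar R).
  by apply/measurable_EFinP; apply: measurable_indic; exact: ma.
rewrite ge0_integral_sum//=.
- apply: eq_bigr => i _; rewrite ge0_integralZl_EFin//; last exact: mI.
  by rewrite integral_indic// setIC.
- by move=> j; apply: measurable_funeM; exact: mI.
- by move=> j w _; rewrite mule_ge0// lee_fin.
Qed.

End finitely_valued.

(** * Existence of conditional expectations *)

Section cond_exp_exists.
Context (R : realType) (dO : measure_display) (Om : measurableType dO).
Context (P : probability Om R) (d : measure_display) (S : measurableType d).
Context (W : {mfun Om >-> S}) (Z : Om -> R).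
Hypotheses (mZ : measurable_fun [set: Om] Z) (Z0 : forall w, 0 <= Z w).
Hypothesis Z1 : forall w, Z w <= 1.

Let nu (A : set S) := (\int[P]_(w in W @^-1` A) (Z w)%:E)%E.

Let mW A : measurable A -> measurable (W @^-1` A).
Proof. by move=> mA; rewrite -[_ @^-1` _]setTI; exact: measurable_funPT. Qed.

Let mEZ D : measurable_fun D (EFin \o Z).
Proof. by apply: measurable_funTS; exact/measurable_EFinP. Qed.

Let nu_le A : measurable A -> (nu A <= P (W @^-1` A))%E.
Proof.
move=> mA; rewrite -[leRHS]mul1e -integral_cst; last exact: mW.
by apply: ge0_le_integral => //; [exact: mW|..] => *; rewrite lee_fin.
Qed.

Let nu0 : nu set0 = 0%E.
Proof. by rewrite /nu preimage_set0 integral_set0. Qed.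

Let nu_ge0 A : (0 <= nu A)%E.
Proof. by apply: integral_ge0 => *; rewrite lee_fin. Qed.

Let nu_sigma_additive : semi_sigma_additive nu.
Proof.
move=> F mF tF mUF; rewrite /nu preimage_bigcup.
apply: semi_sigma_additive_nng_induced.
- exact: mEZ.
- by move=> w; rewrite lee_fin.
- by move=> k; exact: mW.
- apply/trivIsetP => /= i j _ _ ij; rewrite -preimage_setI.
  by move/trivIsetP : tF => /(_ _ _ _ _ ij) ->//; rewrite preimage_set0.
- by rewrite -preimage_bigcup; exact: mW.
Qed.

HB.instance Definition _ := isMeasure.Build _ _ _ nu nu0 nu_ge0
  nu_sigma_additive.

Let nu_fin : fin_num_fun nu.
Proof.
move=> A mA; rewrite ge0_fin_numE// (le_lt_trans (nu_le mA))//.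
by rewrite (le_lt_trans (probability_le1 P (mW mA)))// ltry.
Qed.

HB.instance Definition _ := Measure_isFinite.Build _ _ _ nu nu_fin.

(** The Bayes rules constrain given versions of conditional expectations, so versions must exist.
    The Radon-Nikodym density of [nu] with respect to the law of [W] is one; its sign serves the
    comparison of integrals below. *)
Lemma cond_exp_exists :
  exists2 phi : S -> R, is_cond_exp P W Z phi & forall s, 0 <= phi s.
Proof.
have nuP : nu `<< distribution P W.
  apply/null_content_dominatesP => A mA PA0.
  apply/eqP; rewrite eq_le nu_ge0 andbT.
  by rewrite -[leRHS]PA0 nu_le.
have [f [f0 ffin fint nuE]] := radon_nikodym_sigma_finite nuP.
have mf : measurable_fun [set: S] (fine \o f).
  by apply: measurableT_comp => //; exact: measurable_int fint.
have fE s : (fine (f s))%:E = f s by rewrite fineK.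
have intE B : measurable B ->
    (\int[P]_(w in W @^-1` B) (fine (f (W w)))%:E =
     \int[P]_(w in W @^-1` B) (Z w)%:E)%E.
  move=> mB; rewrite -/(nu B) nuE// ge0_integral_pushforward//.
    by apply: eq_integral => w _; rewrite fE.
  exact: measurable_funTS (measurable_int _ fint).
exists (fine \o f); last by move=> s; rewrite fine_ge0.
split => //.
apply/integrableP; split.
  by apply/measurable_EFinP; apply: measurableT_comp.
under eq_integral do rewrite gee0_abs ?lee_fin ?fine_ge0//.
have := intE _ measurableT; rewrite preimage_setT => ->.
by rewrite -(@preimage_setT _ _ W) (le_lt_trans (nu_le measurableT))//
  preimage_setT probability_setT ltry.
Qed.

End cond_exp_exists.

(** * Bayes rules in integrated form *)

Section observations.
Context (R : realType) (J : nat) (dO : measure_display) (Om : measurableType dO).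
Context (P : probability Om R) (d : measure_display) (T : measurableType d).
Context (X : nat -> Om -> 'I_J) (Y : nat -> Om -> T).
Hypothesis mX : forall i x, measurable (X i @^-1` [set x]).
Hypothesis mY : forall i, measurable_fun [set: Om] (Y i).

Lemma measurable_observations n : measurable_fun [set: Om] (observations Y n).
Proof.
apply/measurable_fun_tnthP => i; rewrite (_ : _ \o _ = Y i)//.
by apply/funext => w /=; rewrite tnth_mktuple.
Qed.

Lemma measurable_labels n x : measurable (labels X n @^-1` [set x]).
Proof.
have -> : labels X n @^-1` [set x] = \bigcap_(i : 'I_n) X i @^-1` [set x i].
  apply/seteqP; split => [w /= <- i _/=|w xw]; first by rewrite ffunE.
  by apply/ffunP => i; rewrite ffunE; exact: xw.
by apply: fin_bigcap_measurable => // i _; exact: mX.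
Qed.

Lemma measurable_preimage_observations n (S : set (n.-tuple T)) :
  measurable S -> measurable (observations Y n @^-1` S).
Proof.
by move=> mS; rewrite -[_ @^-1` _]setTI; exact: measurable_observations.
Qed.

Lemma measurable_clusterer_labels n (g : n.-tuple T -> {set {set 'I_n}}) i :
  is_clusterer g ->
  measurable ((fun w => (g (observations Y n w), labels X n w)) @^-1` [set i]).
Proof.
move=> [_ mg]; case: i => C x.
rewrite (_ : _ @^-1` _ = observations Y n @^-1` (g @^-1` [set C]) `&`
                         labels X n @^-1` [set x]).
  apply: measurableI; last exact: measurable_labels.
  exact: measurable_preimage_observations.
by apply/seteqP; split => w /= [-> ->].
Qed.

(** Integrating the almost sure comparison of the risks over an event removes conditional
    expectations from the rest of the argument. *)
Lemma bayes_clusterer_le_integral n (g g' : n.-tuple T -> {set {set 'I_n}})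
    (S : set (n.-tuple T)) :
  is_bayes_clusterer P X Y g -> is_clusterer g' -> measurable S ->
  (\int[P]_(w in observations Y n @^-1` S)
     (loss R (g (observations Y n w)) (label_partition (labels X n w)))%:E <=
   \int[P]_(w in observations Y n @^-1` S)
     (loss R (g' (observations Y n w)) (label_partition (labels X n w)))%:E)%E.
Proof.
move=> [cg opt] cg' mS.
pose Yn : {mfun Om >-> n.-tuple T} :=
  HB.pack (observations Y n) (isMeasurableFun.Build _ _ _ _ _
    (@measurable_observations n)).
have risk (f : n.-tuple T -> {set {set 'I_n}}) : is_clusterer f ->
    exists2 phi : n.-tuple T -> R, is_cond_exp P Yn (fun w =>
      loss R (f (Yn w)) (label_partition (labels X n w))) phi &
      forall s, 0 <= phi s.
  move=> cf; apply: cond_exp_exists => [|w|w].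
  - exact: (measurable_finitely_valued
      (fun i => measurable_clusterer_labels i cf)
      (fun i => loss R i.1 (label_partition i.2))).
  - by apply: loss_ge0; case: cf.
  - exact: loss_le1.
have [phi [mphi iphi phiE] phi0] := risk _ cg.
have [phi' [mphi' iphi' phi'E] phi'0] := risk _ cg'.
have := opt _ cg' phi phi' (And3 mphi iphi phiE) (And3 mphi' iphi' phi'E).
move=> ae_le.
rewrite -[leLHS](phiE S)// -[leRHS](phi'E S)//; apply: ae_ge0_le_integral.
- exact: measurable_preimage_observations.
- by move=> w _; rewrite lee_fin.
- exact: measurable_funTS (measurable_int _ iphi).
- by move=> w _; rewrite lee_fin.
- exact: measurable_funTS (measurable_int _ iphi').
- by apply: filterS ae_le => w le _; rewrite lee_fin.
Qed.

(** The same integration, a maximum being at least each of its terms. *)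
Lemma bayes_classifier_ge n (h : n.-tuple T -> {ffun 'I_n -> 'I_J}) (i : 'I_n) x
    (S : set (n.-tuple T)) :
  is_bayes_classifier P X Y h -> measurable S ->
  (P (observations Y n @^-1` S `&` [set w | X i w = x]) <=
   P (observations Y n @^-1` S `&` [set w | X i w = h (observations Y n w) i]))%E.
Proof.
move=> [mh opt] mS.
pose Yn : {mfun Om >-> n.-tuple T} :=
  HB.pack (observations Y n) (isMeasurableFun.Build _ _ _ _ _
    (@measurable_observations n)).
have cprob E : measurable E ->
    exists2 phi : n.-tuple T -> R, is_cond_prob P Yn E phi &
      forall s, 0 <= phi s.
  by move=> mE; apply: cond_exp_exists => [|w|w];
    [exact: measurable_indic|rewrite indicE|rewrite indicE lern1 leq_b1].
have mE : measurable [set w | X i w = h (Yn w) i].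
  rewrite (_ : mkset _ = \bigcup_(y in [set: {ffun 'I_n -> 'I_J}])
     (Yn @^-1` (h @^-1` [set y]) `&` X i @^-1` [set y i])).
    apply: fin_bigcup_measurable => // y _; apply: measurableI => //.
    exact: measurable_preimage_observations.
  apply/seteqP; split => [w /= Xw|w [y _ [/= -> ->]]//].
  by exists (h (Yn w)).
have [q [mq iq qE] q0] := cprob _ mE.
have /choice[p pP] : forall y : 'I_J, exists phi : n.-tuple T -> R,
    is_cond_prob P Yn [set w | X i w = y] phi /\ forall s, 0 <= phi s.
  by move=> y; have [phi ? ?] := cprob _ (mX i y); exists phi.
have ae_eq := opt i q p (And3 mq iq qE) (fun y => (pP y).1).
have [[mp ip pE] p0] := pP x.
have mD := measurable_preimage_observations mS.
have le : (\int[P]_(w in Yn @^-1` S) (p x (Yn w))%:E <=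
           \int[P]_(w in Yn @^-1` S) (q (Yn w))%:E)%E.
  apply: ae_ge0_le_integral => //.
  - by move=> w _; rewrite lee_fin.
  - exact: measurable_funTS (measurable_int _ ip).
  - by move=> w _; rewrite lee_fin.
  - exact: measurable_funTS (measurable_int _ iq).
  - apply: filterS ae_eq => w qw _; rewrite lee_fin.
    by rewrite qw le_bigmax.
move: le; rewrite pE// qE// !integral_indic//.
- by rewrite setIC [X in (_ <= P X)%E]setIC.
- exact: mX.
Qed.

End observations.

Lemma trivial_clusterer (d : measure_display) (T : measurableType d) n :
  (0 < n)%N ->
  is_clusterer (fun _ : n.-tuple T => [set [set: 'I_n]]%SET).
Proof.
move=> n0; split => [_|C].
  rewrite /finset.partition /finset.cover big_set1 eqxx /=; apply/andP; split.
    by apply/finset.trivIsetP => A B; rewrite !inE => /eqP -> /eqP ->; rewrite eqxx.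
  by rewrite inE; apply/eqP => /setP/(_ (Ordinal n0)); rewrite !inE.
rewrite (_ : _ @^-1` _ = if C == [set [set: 'I_n]]%SET then setT else set0).
  by case: ifP.
by case: ifPn => [/eqP ->|/eqP CT]; apply/seteqP; split => t //= /esym.
Qed.

(** * The hidden Markov model *)

Section disjoint_densities.
Context (R : realType) (d : measure_display) (T : measurableType d).
Variable L : {measure set T -> \bar R}.

Let pospart (f g : T -> R) y := Num.max (f y - g y) 0.

Let pospart_ge0 f g y : 0 <= pospart f g y.
Proof. by rewrite le_max lexx orbT. Qed.

Let measurable_pospart f g : measurable_fun [set: T] f ->
  measurable_fun [set: T] g -> measurable_fun [set: T] (pospart f g).
Proof.
move=> mf mg; apply: measurable_maxr; last exact: measurable_cst.
exact: measurable_funB.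
Qed.

(** The positive and negative parts of the difference of two densities have disjoint supports. Their
    integrals agree because both densities have mass 1, and are positive because the densities are
    not almost everywhere equal; normalising gives [u] and [v]. *)
Lemma disjoint_densities : two_densities L ->
  exists u v : T -> R, [/\ is_density L u, is_density L v &
    forall y, u y = 0 \/ v y = 0].
Proof.
move=> [f [g [[mf f0 f1] [mg g0 g1] fg]]].
pose p := pospart f g; pose q := pospart g f.
have mp : measurable_fun [set: T] p by exact: measurable_pospart.
have mq : measurable_fun [set: T] q by exact: measurable_pospart.
have mE (h : T -> R) : measurable_fun [set: T] h ->
  measurable_fun [set: T] (fun y => (h y)%:E : \bar R).
  by move=> mh; exact/measurable_EFinP.
have p0 y : 0 <= p y by exact: pospart_ge0.
have q0 y : 0 <= q y by exact: pospart_ge0.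
have fq y : f y + q y = g y + p y.
  rewrite /q /p /pospart.
  by have [?|?] := leP (f y - g y) 0; have [?|?] := leP (g y - f y) 0; lra.
(* Integrating [f + q = g + p] rather than [f - g] keeps all integrands nonnegative. *)
have pq : (\int[L]_y (p y)%:E = \int[L]_y (q y)%:E)%E.
  have : (\int[L]_y (f y)%:E + \int[L]_y (q y)%:E =
          \int[L]_y (g y)%:E + \int[L]_y (p y)%:E)%E.
    rewrite -!ge0_integralD//; try by move=> y _; rewrite lee_fin.
    - by apply: eq_integral => y _; rewrite -!EFinD fq.
    - exact: mE.
    - exact: mE.
    - exact: mE.
    - exact: mE.
  rewrite f1 g1 => /(congr1 (fun z => z - 1)%E).
  by rewrite ![(1 + _)%E]addeC !addeK.
have ple : (\int[L]_y (p y)%:E <= 1)%E.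
  rewrite -f1; apply: ge0_le_integral => //.
  - by move=> y _; rewrite lee_fin.
  - exact: mE.
  - exact: mE.
  - move=> y _; rewrite lee_fin /p /pospart ge_max f0 andbT.
    by rewrite gerBl.
have cE : (fine (\int[L]_y (p y)%:E))%:E = (\int[L]_y (p y)%:E)%E.
  apply: fineK; rewrite ge0_fin_numE ?(le_lt_trans ple (ltry 1))//.
  by apply: integral_ge0 => y _; rewrite lee_fin.
pose c := fine (\int[L]_y (p y)%:E)%E.
have c0 : 0 < c.
  rewrite lt_neqAle eq_sym fine_ge0 ?andbT; last first.
    by apply: integral_ge0 => y _; rewrite lee_fin.
  apply/eqP => c_0; apply: fg.
  have zero (h : T -> R) : measurable_fun [set: T] h -> (forall y, 0 <= h y) ->
      (\int[L]_y (h y)%:E = 0)%E -> {ae L, forall y, h y = 0}.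
    move=> mh h0 ih.
    have /(ae_eq_integral_abs L measurableT (mE _ mh)) :
        (\int[L]_y `|(h y)%:E| = 0)%E.
      by rewrite -[RHS]ih; apply: eq_integral => y _; rewrite gee0_abs ?lee_fin.
    by apply: filterS => y /(_ I) [].
  have ip : (\int[L]_y (p y)%:E = 0)%E by rewrite -cE -/c c_0.
  have := zero _ mp p0 ip.
  have := zero _ mq q0; rewrite -pq => /(_ ip).
  by apply: filterS2 => y qy py; have := fq y; rewrite qy py !addr0.
have normal (h : T -> R) : measurable_fun [set: T] h -> (forall y, 0 <= h y) ->
    (\int[L]_y (h y)%:E = c%:E)%E -> is_density L (fun y => c^-1 * h y).
  move=> mh h0 ih; split.
  - by apply: measurable_funM => //; exact: measurable_cst.
  - by move=> y; rewrite mulr_ge0// invr_ge0 ltW.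
  - under eq_integral do rewrite EFinM.
    rewrite ge0_integralZl_EFin ?invr_ge0 ?(ltW c0)//.
    + by rewrite ih -EFinM mulVf// gt_eqF.
    + by move=> y _; rewrite lee_fin.
    + exact: mE.
exists (fun y => c^-1 * p y), (fun y => c^-1 * q y); split.
- by apply: normal => //; rewrite -cE.
- by apply: normal => //; rewrite -pq -cE.
- move=> y; rewrite /p /q /pospart.
  have [fy|/ltW fy] := leP (f y) (g y); [left|right].
    by rewrite max_r ?mulr0// subr_le0.
  by rewrite max_r ?mulr0// subr_le0.
Qed.

Lemma is_density_mean (f g : T -> R) : is_density L f -> is_density L g ->
  is_density L (fun y => (f y + g y) / 2).
Proof.
move=> [mf f0 f1] [mg g0 g1]; split.
- by apply: measurable_funM; [exact: measurable_funD|exact: measurable_cst].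
- by move=> y; rewrite divr_ge0// addr_ge0.
- under eq_integral do rewrite mulrC EFinM EFinD.
  rewrite ge0_integralZl_EFin ?invr_ge0//.
  + rewrite ge0_integralD ?f1 ?g1//; first by rewrite -EFinD -EFinM mulVf.
    * by move=> y _; rewrite lee_fin.
    * exact/measurable_EFinP.
    * by move=> y _; rewrite lee_fin.
    * exact/measurable_EFinP.
  + by move=> y _; rewrite -EFinD lee_fin addr_ge0.
  + by apply: emeasurable_funD; exact/measurable_EFinP.
Qed.

End disjoint_densities.

(** * Rectangles and measures on tuples *)

Section rectangles.
Context (d : measure_display) (T : measurableType d) (n : nat).

Definition rectangle (A : 'I_n -> set T) : set (n.-tuple T) :=
  [set t | forall i, A i (tnth t i)].

Lemma rectangleT : rectangle (fun=> setT) = setT.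
Proof. by apply/seteqP; split. Qed.

Lemma measurable_rectangle A : (forall i, measurable (A i)) ->
  measurable (rectangle A).
Proof.
move=> mA.
have -> : rectangle A = \bigcap_(i : 'I_n) ((@tnth n T)^~ i @^-1` A i).
  by apply/seteqP; split => [t At i _|t At i]; exact: At.
apply: fin_bigcap_measurable => // i _.
by rewrite -[X in measurable X]setTI; exact: measurable_tnth.
Qed.

(** Rectangles form a pi-system that generates the sigma-field of tuples and contains the whole
    space. *)
Lemma tuple_measure_unique (R : realType)
    (m1 m2 : {measure set (n.-tuple T) -> \bar R}) :
  (forall A, (forall i, measurable (A i)) ->
     m1 (rectangle A) = m2 (rectangle A)) ->
  (m1 setT < +oo)%E -> forall S, measurable S -> m1 S = m2 S.
Proof.
move=> m12 m1oo S mS.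
pose G := [set rectangle A | A in [set A | forall i, measurable (A i)]].
apply: (g_sigma_algebra_measure_unique G _ (fun=> setT)) => //.
- by move=> _ [A mA <-]; exact: measurable_rectangle.
- by move=> _; exists (fun=> setT) => //; exact: rectangleT.
- by apply/seteqP; split => // t _; exists 0%N.
- move=> _ _ [A mA <-] [B mB <-]; exists (fun i => A i `&` B i).
    by move=> i; exact: measurableI.
  by apply/seteqP; split => [t ABt|t [At Bt] i]; [split => i; case: (ABt i)|].
- by move=> _ [A mA <-]; exact: m12.
(* A generator constrains one coordinate, so it is a rectangle with full sides elsewhere. *)
- move: S mS; apply: smallest_sub; first exact: smallest_sigma_algebra.
  rewrite -bigcup_seq => _ [i _ [A mA <-]].
  apply: sub_sigma_algebra; exists (fun j => if j == i then A else setT).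
    by move=> j; case: ifP.
  rewrite setTI; apply/seteqP; split => [t /(_ i)|t At j]; first by rewrite eqxx.
  by case: eqP => // ->.
Qed.

End rectangles.

(** * Weights of the label sequences *)

Section model.
Context (R : realType) (d : measure_display) (T : measurableType d).
Variable L : {measure set T -> \bar R}.
Variables (u v : T -> R).
Hypotheses (du : is_density L u) (dv : is_density L v).
Hypothesis uv : forall y, u y = 0 \/ v y = 0.

Definition absorbing_hmm : param R 2 T :=
  Param (fun x => if x == ord0 then 2 / 3 else 1 / 3)
        (\matrix_(x, x') if x == ord0 then (x' == ord0)%:R else 1 / 2)
        (fun x y => if x == ord0 then (u y + v y) / 2 else v y).

Lemma absorbing_hmm_dep : Theta_dep L absorbing_hmm.
Proof.
split; last first.
  exists ord0, ord_max => /rowP/(_ ord0); rewrite !mxE /= => /eqP.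
  by rewrite eq_sym lt_eqF//; lra.
split.
- split; first by move=> x /=; case: ifP => _; lra.
  by rewrite !big_ord_recl big_ord0 /=; lra.
- split => [x x'|x].
    by rewrite mxE; case: ifP => _; [exact: ler0n|lra].
  rewrite !big_ord_recl big_ord0 !mxE; case: ifP => _ /=; last by lra.
  by rewrite mulr0n mulr1n; lra.
- by move=> x /=; case: (x == ord0) => //; exact: is_density_mean.
Qed.

(* Ratio of the emission densities to v where u vanishes. *)
Definition emis_coef (x : 'I_2) : R := if x == ord0 then 1 / 2 else 1.

Lemma integral_emis x (A : set T) : measurable A -> (forall y, A y -> u y = 0) ->
  (\int[L]_(y in A) (emis absorbing_hmm x y)%:E =
   (emis_coef x)%:E * \int[L]_(y in A) (v y)%:E)%E.
Proof.
case: du dv => [mu u0 _] [mv v0 _] mA uA; rewrite /= /emis_coef.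
case: ifP => _; last by rewrite mul1e.
rewrite -ge0_integralZl_EFin//.
- apply: eq_integral => y; rewrite inE => Ay.
  by rewrite uA// add0r -EFinM div1r mulrC.
- by move=> y _; rewrite lee_fin.
- by apply: measurable_funTS; exact/measurable_EFinP.
Qed.

(** What remains of the joint law of labels and observations where [u] vanishes, once the integrals
    of [v] are factored out. *)
Definition path_weight m (x : {ffun 'I_m.+1 -> 'I_2}) : R :=
  init absorbing_hmm (x (inord 0)) *
  (\prod_(i < m) trans absorbing_hmm (x (inord i)) (x (inord i.+1))) *
  \prod_(i < m.+1) emis_coef (x i).

Lemma path_weight_ge0 m (x : {ffun 'I_m.+1 -> 'I_2}) : 0 <= path_weight x.
Proof.
rewrite /path_weight !mulr_ge0//.
- by rewrite /=; case: ifP => _; lra.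
- apply: prodr_ge0 => i _; rewrite mxE.
  by case: ifP => _; [exact: ler0n|lra].
- by apply: prodr_ge0 => i _; rewrite /emis_coef; case: ifP => _; lra.
Qed.

Definition step_weight (a b : 'I_2) : R := trans absorbing_hmm a b * emis_coef b.

(* Observing no value in the support of u makes the two initial states equally
   likely: (2 / 3) * (1 / 2) = 1 / 3. *)
Lemma path_weightE m (x : {ffun 'I_m.+1 -> 'I_2}) :
  path_weight x =
  1 / 3 * \prod_(i < m) step_weight (x (inord i)) (x (inord i.+1)).
Proof.
rewrite /path_weight big_ord_recl big_split /=.
have -> : \prod_(i < m) emis_coef (x (lift ord0 i)) =
          \prod_(i < m) emis_coef (x (inord i.+1)).
  apply: eq_bigr => i _; congr (emis_coef (x _)).
  by apply/val_inj; rewrite /= inordK// ltnS.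
have -> : inord 0 = ord0 :> 'I_m.+1 by apply/val_inj; rewrite /= inordK.
by rewrite /emis_coef /=; case: ifP => _; field.
Qed.

Definition stair_scale m : R := 1 / 3 * (1 / 2) ^+ m.+1.

Lemma stair_scale_gt0 m : 0 < stair_scale m.
Proof. by rewrite mulr_gt0// exprn_gt0. Qed.

(** Each step contributes 1/2, and the step from 2 to 1 an extra 1/2. The two constant sequences
    lack that step, so they weigh twice as much as the others. *)
Lemma path_weight_stair m k : (k <= m.+1)%N ->
  path_weight (stair m.+1 k) = stair_scale m * (stair_weight m.+1 k)%:R.
Proof.
move=> km; rewrite path_weightE.
(* Transition times emission coefficient: 1/2 * 1 for staying in 2, 1 * 1/2 for staying in 1, 1/2 *
   1/2 for moving from 2 to 1. *)
have stepE (i : 'I_m) :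
    step_weight (stair m.+1 k (inord i)) (stair m.+1 k (inord i.+1)) =
    1 / 2 * (if i.+1 == k then 1 / 2 else 1).
  have im := ltn_ord i.
  rewrite /step_weight /emis_coef mxE !ffunE !inordK ?ltnS//; last exact: ltnW.
  by have [ik|ki|ik] := ltngtP i.+1 k; rewrite /=; field.
rewrite (eq_bigr _ (fun i _ => stepE i)) big_split /= prodr_const card_ord.
rewrite /stair_scale /stair_weight exprS.
have [k0|k_gt0] := posnP k.
  by rewrite k0 big1 => [|i _] //=; field.
have [kE|km1] := eqVneq k m.+1.
  rewrite kE ltnn big1 => [|i _]; first by rewrite /=; field.
  by rewrite eqSS ltn_eqF.
have kpred : (k.-1 < m)%N by lia.
rewrite (bigD1 (Ordinal kpred))//= prednK// eqxx big1 => [|i ik].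
  have -> : (k < m.+1)%N by lia.
  by rewrite /=; field.
rewrite ifF//; apply/negP => /eqP ikE; move/eqP: ik; apply.
by apply/val_inj; rewrite /= -ikE.
Qed.

(** A step from 1 to 2 has probability 0. Without such a step, the sequence is a stair whose
    threshold is the first index with label 1. *)
Lemma path_weight_eq0 m (x : {ffun 'I_m.+1 -> 'I_2}) :
  (forall k, (k <= m.+1)%N -> x <> stair m.+1 k) -> path_weight x = 0.
Proof.
move=> xN; rewrite path_weightE.
have [/existsP[i /andP[/eqP xi xi1]]|/existsPn none] :=
    boolP [exists i : 'I_m, (x (inord i) == ord0) && (x (inord i.+1) != ord0)].
  rewrite (bigD1 i)//= /step_weight mxE xi eqxx (negbTE xi1).
  by rewrite mulr0n !(mul0r, mulr0).
exfalso.
(* If the label 1 never occurs, [find] returns [m.+1] and the sequence is constantly 2. *)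
pose k := find (fun i : 'I_m.+1 => x i == ord0) (enum 'I_m.+1).
have km : (k <= m.+1)%N by rewrite /k -[leqRHS]size_enum_ord find_size.
apply: (xN k km); apply/ffunP => i; rewrite ffunE.
have [ik|ki] := ltnP i k.
  have := before_find ord0 ik; rewrite nth_ord_enum => /negbT.
  move=> xi; apply/val_inj; move: xi; rewrite -val_eqE /=.
  by case: (x i) => [[|[|]]].
have : (k < size (enum 'I_m.+1))%N by rewrite size_enum_ord (leq_ltn_trans ki).
rewrite -has_find => /(nth_find ord0); rewrite -/k => /eqP xk.
have km1 : (k < m.+1)%N by exact: leq_ltn_trans (ltn_ord i).
have {}xk : x (inord k) = ord0.
  rewrite -xk -{2}[k]/(val (Ordinal km1)) nth_ord_enum.
  by congr (x _); apply/val_inj; rewrite /= inordK.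
have xE j : k = j -> x (inord j) = ord0 by move=> <-.
have all0 j : (k <= j)%N -> (j < m.+1)%N -> x (inord j) = ord0.
  elim: j => [|j IH].
    by rewrite leqn0 => /eqP k0 _; exact: xE.
  rewrite leq_eqVlt => /predU1P[kj|kj] jm; first exact: xE.
  have jm1 : (j < m)%N by rewrite -ltnS.
  have := none (Ordinal jm1); rewrite /= IH ?(ltnW jm)// eqxx /= negbK.
  by move=> /eqP.
by rewrite -(all0 i)// inord_val.
Qed.

End model.

(** * Joint law of the labels and the observations where [u] vanishes *)

Section process.
Context (R : realType) (d : measure_display) (T : measurableType d).
Variable L : {measure set T -> \bar R}.
Variables (u v : T -> R).
Hypotheses (du : is_density L u) (dv : is_density L v).
Hypothesis uv : forall y, u y = 0 \/ v y = 0.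
Context (dO : measure_display) (Om : measurableType dO) (P : probability Om R).
Variables (X : nat -> Om -> 'I_2) (Y : nat -> Om -> T).
Hypothesis hmmXY : is_hmm L (absorbing_hmm u v) P X Y.

Let mX := hmm_measX hmmXY.
Let mY := hmm_measY hmmXY.

Local Notation blind n := (rectangle (fun _ : 'I_n => [set y | u y = 0])).

Lemma measurable_blind n : measurable (blind n).
Proof.
apply: measurable_rectangle => _; case: du => mu _ _.
by rewrite -[X in measurable X]setTI; apply: (mu measurableT [set 0]).
Qed.

(** Every emission integral is a multiple of the integral of [v] over the same side; these factors
    join the initial and transition probabilities in [path_weight]. *)
Lemma prob_labels_blind_rectangle m (x : {ffun 'I_m.+1 -> 'I_2})
    (A : 'I_m.+1 -> set T) :
  (forall i, measurable (A i)) -> (forall i y, A i y -> u y = 0) ->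
  (P (labels X m.+1 @^-1` [set x] `&` observations Y m.+1 @^-1` rectangle A) =
   (path_weight u v x)%:E * \prod_(i < m.+1) \int[L]_(y in A i) (v y)%:E)%E.
Proof.
move=> mA uA.
have := hmm_obs hmmXY m (fun i => x (inord i)) (fun i => mA (inord i)).
rewrite (hmm_chain hmmXY) => PE.
transitivity (P [set w | forall i, (i <= m)%N ->
    X i w = x (inord i) /\ A (inord i) (Y i w)]).
  congr (P _); apply/seteqP; split => [w [/= /ffunP xw Aw] i im|w XYw].
    have := xw (inord i); have := Aw (inord i).
    by rewrite ffunE tnth_mktuple inordK.
  split => [|i]; last first.
    by rewrite tnth_mktuple; have [_] := XYw i (ltn_ord i); rewrite inord_val.
  by apply/ffunP => i; rewrite ffunE; have [-> _] := XYw i (ltn_ord i);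
    rewrite inord_val.
rewrite PE /path_weight [X in _ = (X * _)%E]EFinM -muleA; congr (_ * _)%E.
rewrite -prodEFin -big_split /=; apply: eq_bigr => i _.
by rewrite inord_val integral_emis// => y; exact: uA.
Qed.

(** Inside [blind], both sides are finite measures in [S] that agree on rectangles by the product
    formula. The cross-multiplied form allows weights that vanish. *)
Lemma prob_labels_proportional m (x x' : {ffun 'I_m.+1 -> 'I_2})
    (S : set (m.+1.-tuple T)) : measurable S -> S `<=` blind m.+1 ->
  ((path_weight u v x')%:E *
     P (labels X m.+1 @^-1` [set x] `&` observations Y m.+1 @^-1` S) =
   (path_weight u v x)%:E *
     P (labels X m.+1 @^-1` [set x'] `&` observations Y m.+1 @^-1` S))%E.
Proof.
move=> mS SB.
pose Yn := observations Y m.+1.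
have mYn : measurable_fun [set: Om] Yn by exact: measurable_observations.
have mE z : measurable (labels X m.+1 @^-1` [set z] `&` Yn @^-1` blind m.+1).
  apply: measurableI; first exact: measurable_labels.
  by rewrite -[X in measurable X]setTI; apply: mYn => //; exact: measurable_blind.
pose law z : {measure set (m.+1.-tuple T) -> \bar R} :=
  pushforward (mrestr P (mE z)) Yn.
pose scaled (z z' : {ffun 'I_m.+1 -> 'I_2}) :=
  mscale (NngNum (path_weight_ge0 u v z')) (law mYn z).
have scaledE z z' A : A `<=` blind m.+1 -> scaled z z' A =
    ((path_weight u v z')%:E * P (labels X m.+1 @^-1` [set z] `&` Yn @^-1` A))%E.
  move=> AB; congr (_ * P _)%E; rewrite setIC -setIA; congr (_ `&` _).
  by apply: setIidr; exact: preimage_subset.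
rewrite -/Yn -!scaledE//; apply: tuple_measure_unique mS.
  move=> A mA; rewrite -[LHS]/(scaled x x' _) -[RHS]/(scaled x' x _).
  (* The product formula asks for sides inside the zero set of [u]; intersecting with it does not
     change the restricted measures. *)
  pose AB i := A i `&` [set y | u y = 0].
  have mAB i : measurable (AB i).
    apply: measurableI => //; case: du => mu _ _.
    by rewrite -[X in measurable X]setTI; apply: (mu measurableT [set 0]).
  have ABu i y : AB i y -> u y = 0 by case.
  have scaledAB z z' : scaled z z' (rectangle A) = scaled z z' (rectangle AB).
    congr (_ * P _)%E; apply/seteqP; split => w /= [Aw [? Bw]].
      by split.
    by split => // i; case: (Aw i).
  have ABblind : rectangle AB `<=` blind m.+1 by move=> t At i; case: (At i).
  rewrite !scaledAB !scaledE// !prob_labels_blind_rectangle//.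
  by rewrite !muleA -!EFinM [path_weight _ _ _ * _]mulrC.
rewrite -[ltLHS]/(scaled x x' _) /scaled /mscale /=.
rewrite lte_mul_pinfty ?lee_fin ?path_weight_ge0//.
by rewrite /pushforward /mrestr (le_lt_trans (probability_le1 _ _)) ?ltry//;
  rewrite preimage_setT setTI.
Qed.

(** The sequence 2 1^m serves as reference: it is not constant since [0 < m], so its weight is
    exactly [stair_scale]. *)
Lemma prob_labels_stair1 m (x : {ffun 'I_m.+1 -> 'I_2})
    (S : set (m.+1.-tuple T)) : (0 < m)%N ->
  measurable S -> S `<=` blind m.+1 ->
  (P (labels X m.+1 @^-1` [set x] `&` observations Y m.+1 @^-1` S) =
   (path_weight u v x / stair_scale R m)%:E *
   P (labels X m.+1 @^-1` [set stair m.+1 1] `&` observations Y m.+1 @^-1` S))%E.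
Proof.
move=> m0 mS SB.
have s0 := stair_scale_gt0 R m.
have := prob_labels_proportional x (stair m.+1 1) mS SB.
rewrite path_weight_stair// (_ : stair_weight _ _ = 1%N) ?mulr1 => [E|];
  last by rewrite /stair_weight /= ltnS m0.
by rewrite mulrC EFinM -muleA -E muleA -EFinM mulVf ?mul1e// gt_eqF.
Qed.

Lemma sum_path_weight m (F : {ffun 'I_m.+1 -> 'I_2} -> R) :
  \sum_x F x * (path_weight u v x / stair_scale R m) =
  \sum_(k < m.+2) (stair_weight m.+1 k)%:R * F (stair m.+1 k).
Proof.
have s0 := stair_scale_gt0 R m.
pose st (k : 'I_m.+2) := stair m.+1 k.
have st_inj : {in predT &, injective st}.
  by move=> k l _ _ /stair_inj kl; apply/val_inj/kl; rewrite inE -ltnS.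
rewrite (bigID (mem (st @: 'I_m.+2)%SET))/= [X in _ + X]big1 ?addr0; last first.
  move=> x /negP xst; rewrite path_weight_eq0 ?mul0r ?mulr0// => k km xk.
  apply: xst; apply/imsetP; exists (inord k) => //.
  by rewrite /st inordK.
rewrite (big_imset _ st_inj); apply: eq_bigr => k _.
rewrite /st path_weight_stair; last by rewrite -ltnS.
by rewrite [_ * (stair_weight _ _)%:R]mulrC mulfK ?gt_eqF// mulrC.
Qed.

(** The posterior law of the labels is given by the stair weights whatever [S] is; the event enters
    only through one common factor. *)
Lemma integral_labels_blind m (F : {ffun 'I_m.+1 -> 'I_2} -> R)
    (S : set (m.+1.-tuple T)) : (0 < m)%N -> (forall x, 0 <= F x) ->
  measurable S -> S `<=` blind m.+1 ->
  (\int[P]_(w in observations Y m.+1 @^-1` S) (F (labels X m.+1 w))%:E =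
   (\sum_(k < m.+2) (stair_weight m.+1 k)%:R * F (stair m.+1 k))%:E *
   P (labels X m.+1 @^-1` [set stair m.+1 1] `&` observations Y m.+1 @^-1` S))%E.
Proof.
move=> m0 F0 mS SB.
rewrite (integral_finitely_valued (fun x => measurable_labels mX x))//; last first.
  exact: measurable_preimage_observations.
rewrite -sum_path_weight -sumEFin ge0_sume_distrl => [|x _]; last first.
  by rewrite lee_fin mulr_ge0// divr_ge0 ?path_weight_ge0// ltW ?stair_scale_gt0.
apply: eq_bigr => x _; rewrite [in RHS]EFinM -muleA.
by congr (_ * _)%E; rewrite setIC; exact: prob_labels_stair1.

Qed.

(** [v] lives where [u] vanishes, so its integral over that set is 1. *)
Lemma prob_stair1_blind m : (0 < m)%N ->
  (0 < P (labels X m.+1 @^-1` [set stair m.+1 1] `&`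
          observations Y m.+1 @^-1` blind m.+1))%E.
Proof.
move=> m0; rewrite prob_labels_blind_rectangle//; last first.
  move=> _; case: du => mu _ _.
  by rewrite -[X in measurable X]setTI; apply: (mu measurableT [set 0]).
rewrite big1 ?mule1; last first.
  move=> _ _; case: dv => _ _ <-; rewrite integral_mkcond.
  apply: eq_integral => y _; rewrite patchE; case: ifPn => // /negP uy.
  by have [u0|->//] := uv y; case: uy; rewrite inE.
rewrite lte_fin path_weight_stair// (_ : stair_weight _ _ = 1%N) ?mulr1; last first.
  by rewrite /stair_weight /= ltnS m0.
by rewrite mulr_gt0// exprn_gt0.
Qed.

End process.

(** * Comparison of the two Bayes rules *)

Section bayes_rules_differ.
Context (R : realType) (d : measure_display) (T : measurableType d).
Variable L : {measure set T -> \bar R}.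
Variables (u v : T -> R).
Hypotheses (du : is_density L u) (dv : is_density L v).
Hypothesis uv : forall y, u y = 0 \/ v y = 0.
Context (dO : measure_display) (Om : measurableType dO) (P : probability Om R).
Variables (X : nat -> Om -> 'I_2) (Y : nat -> Om -> T).
Hypothesis hmmXY : is_hmm L (absorbing_hmm u v) P X Y.
Variable m : nat.
Hypothesis m0 : (0 < m)%N.
Variables (g : m.+1.-tuple T -> {set {set 'I_m.+1}})
          (h : m.+1.-tuple T -> {ffun 'I_m.+1 -> 'I_2}).
Hypotheses (bg : is_bayes_clusterer P X Y g) (bh : is_bayes_classifier P X Y h).

Let mX := hmm_measX hmmXY.
Let mY := hmm_measY hmmXY.
Let Yn := observations Y m.+1.

Local Notation blind := (rectangle (fun _ : 'I_m.+1 => [set y | u y = 0])).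
(* The sequence 2 1^(n-1) has stair_weight 1, so that P1 plays the role of the
   common factor of the laws of the observations given the label sequences. *)
Local Notation P1 S := (P (labels X m.+1 @^-1` [set stair m.+1 1] `&` Yn @^-1` S)).

Section blind_event.
Variable S : set (m.+1.-tuple T).
Hypotheses (mS : measurable S) (Sblind : S `<=` blind) (PS : (0 < P1 S)%E).

(** The common factor [P1 S] is finite and positive, so it cancels. *)
Let scaled_integral_le (F F' : {ffun 'I_m.+1 -> 'I_2} -> R) :
  (forall x, 0 <= F x) -> (forall x, 0 <= F' x) ->
  (\int[P]_(w in Yn @^-1` S) (F (labels X m.+1 w))%:E <=
   \int[P]_(w in Yn @^-1` S) (F' (labels X m.+1 w))%:E)%E ->
  \sum_(k < m.+2) (stair_weight m.+1 k)%:R * F (stair m.+1 k) <=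
  \sum_(k < m.+2) (stair_weight m.+1 k)%:R * F' (stair m.+1 k).
Proof.
move=> F0 F'0; rewrite !(integral_labels_blind du dv hmmXY)//.
have PE : (fine (P1 S))%:E = P1 S.
  by rewrite fineK// fin_num_measure//; apply: measurableI;
    [exact: measurable_labels|exact: measurable_preimage_observations].
rewrite -PE -!EFinM lee_fin ler_pM2r// -lte_fin PE.
exact: PS.
Qed.

(** Optimality integrated over [S] compares the posterior masses of the two labels at every index,
    which is the setting of [majority_stair]. *)
Lemma classifier_on_blind x : (forall t, S t -> h t = x) ->
  exists2 j, (0 < j < m.+1)%N & x = stair m.+1 j.
Proof.
move=> hS.
have mYS : measurable (Yn @^-1` S) by exact: measurable_preimage_observations.
have countE i c :
    (P (Yn @^-1` S `&` [set w | X (nat_of_ord i) w = c]) =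
     \int[P]_(w in Yn @^-1` S) ((labels X m.+1 w i == c)%:R)%:E)%E.
  rewrite setIC -integral_indic//; last exact: mX.
  apply: eq_integral => w _; rewrite ffunE indicE; congr (_%:R%:E).
  congr nat_of_bool.
  by apply/idP/eqP; rewrite inE.
have count_le (i : 'I_m.+1) c :
    (\sum_(k < m.+2) stair_weight m.+1 k * (stair m.+1 k i == c) <=
     \sum_(k < m.+2) stair_weight m.+1 k * (stair m.+1 k i == x i))%N.
  have := @bayes_classifier_ge _ _ _ _ _ _ _ _ _ mX mY _ _ i c _ bh mS.
  rewrite -/Yn [X in (_ <= P X)%E](_ : _ = Yn @^-1` S `&` [set w | X i w = x i]).
    rewrite !countE => le.
    have /= := @scaled_integral_le (fun z => (z i == c)%:R)
      (fun z => (z i == x i)%:R) (fun z => ler0n _ _) (fun z => ler0n _ _) le.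
    by rewrite -(ler_nat R) !natr_sum;
      under eq_bigr do rewrite -natrM; under [leRHS]eq_bigr do rewrite -natrM.
  by apply/seteqP; split => w [/= Sw ->]; rewrite (hS _ Sw).
have cmax (i : 'I_m.+1) :
    (\sum_(k < m.+2) stair_weight m.+1 k * (stair m.+1 k i == ord_max) =
     m.+2 - i)%N.
  rewrite -(sum_stair_weight_gt (ltn_ord i)); apply: eq_bigr => k _.
  by rewrite ffunE; case: ifP.
have cmin (i : 'I_m.+1) :
    (\sum_(k < m.+2) stair_weight m.+1 k * (stair m.+1 k i == ord0) = i.+2)%N.
  rewrite -(sum_stair_weight_le (ltn_ord i)); apply: eq_bigr => k _.
  by rewrite ffunE; case: ltnP.
apply: majority_stair => // i xi.
  by have := count_le i ord0; rewrite xi cmax cmin; have := ltn_ord i; lia.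
by have := count_le i ord_max; rewrite xi cmax cmin; have := ltn_ord i; lia.
Qed.

(** The one-block clusterer would have a strictly smaller integrated risk on [S]. *)
Lemma clusterer_on_blind j : (0 < j < m.+1)%N ->
  ~ (forall t, S t -> g t = label_partition (stair m.+1 j)).
Proof.
move=> jm gS.
have [t St] : S !=set0.
  apply/set0P/eqP => S0; move: PS.
  by rewrite S0 preimage_set0 setI0 measure0 ltxx.
(* Nonnegativity of the loss rests on this; it is read off from the value of [g] at a point of
   [S]. *)
have part : finset.partition (label_partition (stair m.+1 j)) [set: 'I_m.+1]%SET.
  by rewrite -(gS t St); case: bg => -[].
have ctriv := @trivial_clusterer _ T m.+1 isT.
have := bayes_clusterer_le_integral mX mY bg ctriv mS.
rewrite -/Yn (eq_integral (fun w => (loss R (label_partition (stair m.+1 j))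
    (label_partition (labels X m.+1 w)))%:E)); last first.
  by move=> w; rewrite inE => /gS ->.
have /= := @scaled_integral_le
  (fun x => loss R (label_partition (stair m.+1 j)) (label_partition x))
  (fun x => loss R [set [set: 'I_m.+1]]%SET (label_partition x)).
move=> /[apply] le.
have {le} := le (fun=> loss_ge0 _ _ part) (fun=> loss_ge0 _ _ (ctriv.1 t)).
rewrite !sum_loss lerD2l lerN2 ler_pM2l ?invr_gt0 ?ltr0n// ler_nat leqNgt.
by rewrite trivial_beats_stair.
Qed.

End blind_event.

(** The pair of rules takes finitely many values, so one value has positive mass together with the
    reference sequence and [blind]. On the corresponding event both rules are constant; if they
    agreed there, the two preceding lemmas would contradict each other. *)
Lemma bayes_rules_differ :
  (0 < P [set w | g (Yn w) <> label_partition (h (Yn w))])%E.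
Proof.
pose a w := (g (Yn w), h (Yn w)).
have mgh C x : measurable (g @^-1` [set C] `&` h @^-1` [set x]).
  by apply: measurableI; [exact: bg.1.2|exact: bh.1].
have aE C x : a @^-1` [set (C, x)] =
    Yn @^-1` (g @^-1` [set C] `&` h @^-1` [set x]).
  by apply/seteqP; split => w; rewrite /a /= => -[-> ->].
have ma i : measurable (a @^-1` [set i]).
  by case: i => C x; rewrite aE; exact: measurable_preimage_observations.
rewrite -[X in P X]/(a @^-1` [set i | i.1 <> label_partition i.2]).
rewrite lt_neqAle measure_ge0 andbT eq_sym; apply/eqP => bad0.
pose D := labels X m.+1 @^-1` [set stair m.+1 1] `&` Yn @^-1` blind.
have mblind : measurable blind by exact: (measurable_blind du).
have mD : measurable D.
  by apply: measurableI;
    [exact: measurable_labels|exact: measurable_preimage_observations].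
have [[C x] PCx] : exists i, (0 < P (D `&` a @^-1` [set i]))%E.
  apply: contrapT => /forallNP noi.
  have := prob_stair1_blind du dv uv hmmXY m0; rewrite -/Yn -/D.
  have := integral_finitely_valued (F := fun=> 1%R) ma P (fun=> ler01) mD.
  rewrite integral_cst// mul1e => ->; rewrite big1 ?ltxx// => i _.
  rewrite mul1e; apply/eqP; rewrite eq_le measure_ge0 andbT leNgt.
  by apply/negP; exact: noi.
pose S := blind `&` (g @^-1` [set C] `&` h @^-1` [set x]).
have mS : measurable S by exact: measurableI.
have Sblind : S `<=` blind by move=> t [].
have PS : (0 < P1 S)%E.
  by move: PCx; rewrite aE /D -setIA.
(* Otherwise an event of positive probability would lie in the null event where the rules differ. *)
have CE : C = label_partition x.
  apply: contrapT => Cx; move: PCx; rewrite ltNge => /negP; apply.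
  rewrite -bad0; apply: le_measure; rewrite ?inE.
  - exact: measurableI.
  - exact: measurable_finite_preimage.
  - by move=> w [_]; rewrite /a /= => -[-> ->].
have [j jm xE] := classifier_on_blind mS Sblind PS
  (fun t (St : S t) => proj2 (proj2 St)).
apply: (clusterer_on_blind mS Sblind PS jm) => t [_ [/= -> _]].
by rewrite CE xE.
Qed.

End bayes_rules_differ.

Theorem theorem8 (R : realType) (T : ptopologicalType) (polishT : polish R T)
    (L : {measure set (borel T) -> \bar R}) (densL : two_densities L) :
  exists Theta' : set (param R 2 (borel T)),
    [/\ Theta' !=set0, Theta' `<=` Theta_dep (J := 2) L
      & forall th : param R 2 (borel T), Theta' th ->
        forall n : nat, (2 <= n)%N ->
        forall (dO : measure_display) (Om : measurableType dO)
          (P : probability Om R)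
          (X : nat -> Om -> 'I_2) (Y : nat -> Om -> borel T),
        is_hmm L th P X Y ->
        forall (g : n.-tuple (borel T) -> {set {set 'I_n}})
          (h : n.-tuple (borel T) -> {ffun 'I_n -> 'I_2}),
        is_bayes_clusterer P X Y g -> is_bayes_classifier P X Y h ->
        (0 < P [set w | g (observations Y n w) <>
                        label_partition (h (observations Y n w))])%E].
Proof.
have [u [v [du dv uv]]] := disjoint_densities densL.
(* One parameter serves all [n], since neither the chain nor the densities depend on [n]. *)
exists [set absorbing_hmm u v]; split.
- by exists (absorbing_hmm u v).
- by move=> _ ->; exact: absorbing_hmm_dep.
move=> _ -> [//|m] m1 dO Om P X Y hmmXY g h.
exact: (bayes_rules_differ du dv uv hmmXY).
Qed.
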